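(* For any $k$, $\alpha$, $m$ (with $1\le m\le k$ and $0<\alpha<1$), writing $a=\lfloor 1/\alpha\rfloor$, $$\frac{n}{a}+m\log a-c_1(k)\le g(n,k,\alpha,m)\le \frac{n}{a}+m\log a+c_2(k),$$ where $c_1(k)$ and $c_2(k)$ depend only on $k$.
   Context: All logarithms are binary. Let $[n]=\{1,\dots,n\}$ be an underlying set of size $n$ which contains at least $k$ defective elements; which elements are defective is unknown. One may ask questions $Q\subseteq[n]$; the answer to $Q$ is YES if and only if there are at least $\alpha|Q|$ defective elements in $Q$, and NO otherwise. Questions are asked adaptively (each question may depend on the previous answers), and question sets are supposed to have size at most $k/\alpha$. The number $g(n,k,\alpha,m)$ is the least number of questions needed (in the worst case) to find $m$ defective elements in this setting.
   Formalization: The lower bound is proved under the extra hypothesis a ≤ n; without it the claim fails, e.g. for n = k = m = 1, where g = 0 but n/a + m log a is unbounded as α → 0. The upper bound needs no such hypothesis. *)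

(* Defs.v *)
From HB Require Import structures.
From mathcomp Require Import all_boot all_order all_algebra.
From mathcomp Require Import all_classical all_reals all_analysis.

Set Implicit Arguments.
Unset Strict Implicit.
Unset Printing Implicit Defensive.

Import Order.TTheory GRing.Theory Num.Theory.

Local Open Scope ring_scope.

Definition log2 (R : realType) (x : R) : R := ln x / ln 2.

(* Adaptive algorithms on the ground set 'I_n, as binary decision trees:
   [Ask Q tyes tno] asks Q and goes on with [tyes] or [tno] according to the
   answer, [Output M] stops and claims that all elements of M are defective. *)
Inductive strategy (n : nat) : Type :=
| Output of {set 'I_n}
| Ask of {set 'I_n} & strategy n & strategy n.

(* [D] is the unknown set of defective elements. *)
Definition answer (R : realType) (n : nat) (alpha : R) (D Q : {set 'I_n}) : bool :=
  alpha * #|Q|%:R <= #|Q :&: D|%:R.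

Fixpoint output (R : realType) (n : nat) (alpha : R) (t : strategy n)
    (D : {set 'I_n}) : {set 'I_n} :=
  match t with
  | Output M => M
  | Ask Q tyes tno => output alpha (if answer alpha D Q then tyes else tno) D
  end.

Fixpoint nquestions (R : realType) (n : nat) (alpha : R) (t : strategy n)
    (D : {set 'I_n}) : nat :=
  match t with
  | Output _ => 0%N
  | Ask Q tyes tno =>
      (nquestions alpha (if answer alpha D Q then tyes else tno) D).+1
  end.

Fixpoint small_questions (R : realType) (n k : nat) (alpha : R)
    (t : strategy n) : Prop :=
  match t with
  | Output _ => True
  | Ask Q tyes tno =>
      [/\ #|Q|%:R <= k%:R / alpha, small_questions k alpha tyes
        & small_questions k alpha tno]
  end.

Definition finds (R : realType) (n k : nat) (alpha : R) (m : nat)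
    (t : strategy n) : Prop :=
  forall D : {set 'I_n}, (k <= #|D|)%N ->
    #|output alpha t D| = m /\ output alpha t D \subset D.

Definition suffices (R : realType) (n k : nat) (alpha : R) (m q : nat) : Prop :=
  exists t : strategy n,
    [/\ small_questions k alpha t, finds k alpha m t
      & forall D : {set 'I_n}, (k <= #|D|)%N -> (nquestions alpha t D <= q)%N].

(* The value is 0 if no number of questions suffices; [g_least] below shows
   that this default is not used when 1 <= m <= k and 0 < alpha < 1. *)
Definition g (R : realType) (n k : nat) (alpha : R) (m : nat) : nat :=
  xget 0%N [set q : nat | suffices n k alpha m q /\
                          forall p, suffices n k alpha m p -> (q <= p)%N].

Fixpoint ask_singletons n (m : nat) (s : seq 'I_n) (Y : {set 'I_n}) : strategy n :=
  match s with
  | [::] => Output [set x in take m (enum Y)]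
  | x :: s' =>
      Ask [set x] (ask_singletons m s' (x |: Y)) (ask_singletons m s' Y)
  end.

Lemma g_least (R : realType) (n k : nat) (alpha : R) (m : nat) :
  (1 <= m <= k)%N -> 0 < alpha < 1 ->
  suffices n k alpha m (g n k alpha m) /\
  forall p, suffices n k alpha m p -> (g n k alpha m <= p)%N.
Proof.
move=> /andP[m1 mk] /andP[a0 a1].
have ans (D : {set 'I_n}) x : answer alpha D [set x] = (x \in D).
  rewrite /answer cards1 mulr1; case: (boolP (x \in D)) => xD.
    by rewrite (finset.setIidPl _) ?finset.sub1set// cards1 ltW.
  suff -> : [set x] :&: D = finset.set0 by rewrite cards0 leNgt a0.
  by apply/finset.setP => y; rewrite !inE; case: eqP => // ->; rewrite (negbTE xD).
have ka : 1%:R <= k%:R / alpha :> R.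
  rewrite ler_pdivlMr// mul1r (le_trans (ltW a1))// ler1n.
  exact: leq_trans m1 mk.
have small s Y : small_questions k alpha (@ask_singletons n m s Y).
  by elim: s Y => //= x s IH Y; split=> //; rewrite cards1.
have nq s Y D : nquestions alpha (@ask_singletons n m s Y) D = size s.
  by elim: s Y => //= x s IH Y; case: ifP => _; rewrite IH.
have out s Y D : output alpha (@ask_singletons n m s Y) D =
    [set x in take m (enum (Y :|: [set x in s] :&: D))].
  elim: s Y => /= [|x s IH] Y.
    by rewrite (_ : _ :|: _ = Y)//; apply/finset.setP => y; rewrite !inE orbF.
  rewrite ans; case: ifPn => xD; rewrite IH.
    rewrite (_ : x |: Y :|: _ = Y :|: [set z in x :: s] :&: D)//.
    apply/finset.setP => y; rewrite !inE; case: eqVneq => [->|] //=.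
    by rewrite xD orbT.
  rewrite (_ : Y :|: [set z in s] :&: D = Y :|: [set z in x :: s] :&: D)//.
  apply/finset.setP => y; rewrite !inE; case: eqVneq => [->|] //=.
  by rewrite (negbTE xD) !andbF.
have sn : suffices n k alpha m n.
  exists (ask_singletons m (enum 'I_n) finset.set0); split => [|D kD|D kD].
  - exact: small.
  - rewrite out (_ : _ :|: _ = D); last first.
      by apply/finset.setP => y; rewrite !inE mem_enum.
    split.
      rewrite cardsE (card_uniqP _) ?take_uniq ?enum_uniq//.
      by rewrite size_takel// -cardE (leq_trans mk).
    apply/fintype.subsetP => y; rewrite inE => /mem_take.
    by rewrite mem_enum.
  - by rewrite nq size_enum_ord.
have ex : exists q, `[< suffices n k alpha m q >] by exists n; apply/asboolP.
rewrite /g; case: xgetP => [q -> //|none].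
case: (ex_minnP ex) => q /asboolP sq minq.
by case: (none q); split => // p sp; apply: minq; apply/asboolP.
Qed.

(* Main.v *)
Require Import Defs.
From HB Require Import structures.
From mathcomp Require Import all_boot all_order all_algebra.
From mathcomp Require Import all_classical all_reals all_analysis.
From mathcomp Require Import zify ring lra.

(** Only the integer a = floor (1 / alpha) matters: a nonempty question of size
    at most a is answered YES as soon as it meets the defective set, while a
    larger question needs at least two defectives for a YES.

    Upper bound. Questions of size at most a are ordinary group tests. Keep a
    set Y of defectives already found and a set U that contains all the others;
    test a group of min (a, #|U|) elements of U. A NO removes the group from U,
    and this happens at most n / a + 1 times; a YES is followed by a binary
    search that costs at most log a + 1 further questions and yields a new
    defective, and this happens m times ([achieves_groups], [suffices_upper]).
    The surplus is at most 2 * m + 1, which is bounded in terms of k.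

    Lower bound. For q0 = n / a - 4 * k ^ 4 rounds an adversary answers NO
    whenever it can. A question of size at most a then costs it the elements of
    that question; a larger one only obliges it to keep at most one defective in
    the question ([stall_strategy]). If l of the answered questions were large,
    at least a * (4 * k ^ 4 + l) elements survive (and all n of them if n / a is
    too small for any round to be played). The large questions have at
    most 2 * k * a elements each, so they contain few pairs compared with all
    pairs of survivors, and by a union bound at least half of the k-subsets of
    the set W of survivors meet each large question in at most one element
    ([half_ksubsets_sparse]). All these k-subsets remain possible outcomes.
    A leaf with output M accounts only for those containing M, a proportion of
    at most (k / #|W|) ^ m of all the k-subsets, so the rest of the tree has
    depth at least m * log (#|W| / k) - 1 ([expn_card_le]). As #|W| >= a, this
    leaves n / a + m * log a up to a term depending on k alone ([suffices_lower]). *)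

Set Implicit Arguments.
Unset Strict Implicit.
Unset Printing Implicit Defensive.

Import Order.TTheory GRing.Theory Num.Theory.

Local Open Scope ring_scope.
Local Open Scope nat_scope.

(** * Counting subsets of a given size *)

Lemma exists_subset_card (T : finType) (S : {set T}) (i : nat) : i <= #|S| ->
  exists2 Q : {set T}, Q \subset S & #|Q| = i.
Proof.
move=> iS; exists [set x in take i (enum S)].
  by apply/fintype.subsetP => x; rewrite inE => /mem_take; rewrite mem_enum.
by rewrite cardsE (card_uniqP _) ?take_uniq ?enum_uniq // size_takel // -cardE.
Qed.

Lemma ffactnD (n j p : nat) : n ^_ (j + p) = n ^_ j * (n - j) ^_ p.
Proof.
by elim: p => [|p IH]; rewrite ?addn0 ?muln1 // addnS !ffactnSr IH subnDA mulnA.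
Qed.

Lemma bin_mul_ffact (n k j : nat) : j <= k ->
  'C(n - j, k - j) * n ^_ j = 'C(n, k) * k ^_ j.
Proof.
move=> jk; apply/eqP; rewrite -(eqn_pmul2r (fact_gt0 (k - j))); apply/eqP.
rewrite -[in RHS]mulnA ffact_fact // bin_ffact mulnAC bin_ffact mulnC.
have [jn|nj] := leqP j n; last first.
  by rewrite (ffact_small nj) mul0n ffact_small ?(leq_trans nj).
by rewrite -[in RHS](subnKC jk) ffactnD.
Qed.

(** A random k-subset of W contains a given M with probability
    k ^_ #|M| / #|W| ^_ #|M|; cross-multiplied, the bound also covers M larger
    than k or not contained in W, where the count is zero. *)
Lemma card_ksubset_supset (T : finType) (W M : {set T}) (k : nat) :
  #|[set D : {set T} | [&& D \subset W, #|D| == k & M \subset D]]|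
      * #|W| ^_ #|M|
    <= 'C(#|W|, k) * k ^_ #|M|.
Proof.
set F := [set D | _].
have [MW|MW] := boolP (M \subset W); last first.
  suff -> : F = finset.set0 by rewrite cards0.
  apply/finset.setP => D; rewrite !inE; apply/negbTE; apply: contra MW.
  by case/and3P => DW _ MD; apply: fintype.subset_trans DW.
have [kM|Mk] := ltnP k #|M|.
  suff -> : F = finset.set0 by rewrite cards0.
  apply/finset.setP => D; rewrite !inE; apply/negbTE/negP.
  case/and3P => _ /eqP Dk MD; have := subset_leq_card MD.
  by rewrite Dk leqNgt kM.
rewrite -bin_mul_ffact // leq_mul2r; apply/orP; right.
have <- : #|W :\: M| = #|W| - #|M| by rewrite cardsD (finset.setIidPr MW).
rewrite -cards_draws -(card_in_imset (f := fun D : {set T} => D :\: M)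
                                        (D := mem F)).
  apply/subset_leq_card/fintype.subsetP => _ /imsetP[D DF ->].
  move: DF; rewrite !inE => /and3P[DW /eqP <- MD].
  by rewrite finset.setSD //= cardsD (finset.setIidPr MD).
move=> D E /[!inE] /and3P[_ _ MD] /and3P[_ _ ME] eqDE.
rewrite -(finset.setID D M) -(finset.setID E M) eqDE.
by rewrite (finset.setIidPr MD) (finset.setIidPr ME).
Qed.

(** Union bound over the ordered pairs of distinct elements of Q. *)
Lemma card_ksubset_meet2 (T : finType) (W Q : {set T}) (k : nat) :
  #|[set D : {set T} | [&& D \subset W, #|D| == k & 1 < #|Q :&: D|]]|
      * #|W| ^_ 2
    <= #|Q| ^ 2 * ('C(#|W|, k) * k ^_ 2).
Proof.
pose F (p : T * T) :=
  [set D : {set T} | [&& D \subset W, #|D| == k & [set p.1; p.2] \subset D]].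
pose P := [set p : T * T | [&& p.1 \in Q, p.2 \in Q & p.1 != p.2]].
apply: (@leq_trans ((\sum_(p in P) #|F p|) * #|W| ^_ 2)).
  rewrite leq_mul2r; apply/orP; right.
  apply: (@leq_trans #|\bigcup_(p in P) F p|).
    apply/subset_leq_card/fintype.subsetP => D; rewrite !inE.
    case/and3P => DW Dk /card_gt1P[x [y [/setIP[xQ xD] /setIP[yQ yD] xy]]].
    apply/finset.bigcupP; exists (x, y); first by rewrite inE xQ yQ.
    by rewrite inE DW Dk finset.subUset !finset.sub1set xD yD.
  elim/big_rec2: _ => [|p s A _ IH]; first by rewrite cards0.
  by rewrite (leq_trans (leq_card_setU _ _)) // leq_add2l.
rewrite big_distrl /=; apply: (@leq_trans (\sum_(p in P) 'C(#|W|, k) * k ^_ 2)).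
  apply: leq_sum => p; rewrite inE => /and3P[_ _ pne].
  have := card_ksubset_supset W [set p.1; p.2] k.
  by rewrite cards2 pne.
rewrite sum_nat_const leq_mul2r expnS expn1 -cardsX; apply/orP; right.
by apply/subset_leq_card/fintype.subsetP => -[x y]; rewrite !inE => /and3P[-> ->].
Qed.

Definition sparse_ksubsets (T : finType) (W : {set T}) (k : nat)
    (L : seq {set T}) :=
  [set D : {set T} | [&& D \subset W, #|D| == k
                       & all (fun Q => #|Q :&: D| <= 1) L]].

(** The second hypothesis makes the union bound over the questions of L at most
    one half: a k-subset meets a given Q twice with probability at most
    b ^ 2 * k ^_ 2 / #|W| ^_ 2. *)
Lemma half_ksubsets_sparse (T : finType) (W : {set T}) (k b : nat)
    (L : seq {set T}) :
  all (fun Q : {set T} => #|Q| <= b) L ->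
  2 * (size L * (b ^ 2 * k ^_ 2)) <= #|W| ^_ 2 ->
  'C(#|W|, k) <= 2 * #|sparse_ksubsets W k L|.
Proof.
move=> Lb Lsmall.
pose A := [set D : {set T} | D \subset W & #|D| == k].
pose B L := [set D : {set T} | [&& D \subset W, #|D| == k
                                & has (fun Q => 1 < #|Q :&: D|) L]].
have cA : #|A| = 'C(#|W|, k) by rewrite cards_draws.
have AB : #|A| = #|B L| + #|sparse_ksubsets W k L|.
  rewrite -(cardsID (B L) A); congr (_ + _); apply: eq_card => D; rewrite !inE.
    by case: (_ \subset _); case: (_ == _).
  have -> : has (fun Q => 1 < #|Q :&: D|) L = ~~ all (fun Q => #|Q :&: D| <= 1) L.
    by rewrite -has_predC; apply: eq_has => Q /=; rewrite ltnNge.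
  by case: (_ \subset _); case: (_ == _) => //=; rewrite ?andbT negbK.
have cB : #|B L| * #|W| ^_ 2 <= size L * (b ^ 2 * ('C(#|W|, k) * k ^_ 2)).
  elim: L Lb {Lsmall AB} => [|Q L IH] /=.
    rewrite (_ : B [::] = finset.set0) ?cards0 //.
    by apply/finset.setP => D; rewrite !inE !andbF.
  case/andP => Qb /IH{}IH.
  rewrite mulSn; apply: leq_trans (leq_add _ IH).
    2: exact: leq_trans (card_ksubset_meet2 W Q k)
                        (leq_mul (leq_mul Qb Qb) (leqnn _)).
  rewrite -mulnDl leq_mul2r; apply/orP; right.
  rewrite (leq_trans _ (leq_card_setU _ _)) //.
  apply/subset_leq_card/fintype.subsetP => D.
  by rewrite !inE; case: (_ \subset _); case: (_ == _).
(* With at most one element in W the bound cB says nothing, but then no D can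
   meet a question twice. *)
have [W1|W1] := leqP #|W| 1.
  suff B0 : B L = finset.set0 by rewrite -cA AB B0 cards0; lia.
  apply/finset.setP => D; rewrite !inE; apply/negbTE/negP => /and3P[DW _ /hasP[Q _]].
  apply/negP; rewrite -leqNgt (leq_trans _ W1) // subset_leq_card //.
  by rewrite (fintype.subset_trans _ DW) // finset.subsetIr.
have W2 : 0 < #|W| ^_ 2 by rewrite ffact_gt0.
suff : 2 * #|B L| <= #|A| by rewrite -cA; lia.
rewrite -(leq_pmul2r W2) cA.
apply: (@leq_trans ('C(#|W|, k) * (2 * (size L * (b ^ 2 * k ^_ 2))))).
  by rewrite -mulnA; move: cB; rewrite -(leq_pmul2l (ltn0Sn 1)); nia.
by rewrite leq_mul2l Lsmall orbT.
Qed.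

(** Each ratio (N - i) / (k - i) is at least N / k. *)
Lemma expn_ffact_le (N k m : nat) : m <= k -> k <= N ->
  N ^ m * k ^_ m <= N ^_ m * k ^ m.
Proof.
move=> + kN; elim: m => [//|m IH] mk; have {}IH := IH (ltnW mk).
rewrite !ffactnSr !expnSr.
have H : N * (k - m) <= (N - m) * k by nia.
by have := leq_mul IH H; nia.
Qed.

(** * Lower bound: the adversary *)

Lemma answer_set0 (R : realType) (alpha : R) (n : nat) (D : {set 'I_n}) :
  answer alpha D finset.set0.
Proof. by rewrite /answer cards0 mulr0 ler0n. Qed.

Lemma answer_disjoint (R : realType) (alpha : R) (n : nat) (D Q : {set 'I_n}) :
  (0 < alpha)%R -> Q != finset.set0 -> #|Q :&: D| = 0 -> answer alpha D Q = false.
Proof.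
move=> alpha_gt0 Q0 QD; apply/negbTE; rewrite /answer QD -ltNge mulr_gt0 // ltr0n.
by rewrite card_gt0.
Qed.


Section LowerBound.

Variables (R : realType) (alpha : R) (n k a : nat).
Hypothesis alpha_gt0 : (0 < alpha)%R.
Hypothesis alpha_aS_gt1 : (1 < alpha * a.+1%:R)%R.
Hypothesis a_gt0 : 0 < a.

Implicit Types (D Q S U W Y : {set 'I_n}) (t : strategy n).

Lemma answer_large D Q : a < #|Q| -> #|Q :&: D| <= 1 -> answer alpha D Q = false.
Proof.
move=> aQ QD; apply/negbTE; rewrite /answer -ltNge.
apply: (le_lt_trans (y := 1%R)); first by rewrite -[1%R]/(1%:R)%R ler_nat.
by rewrite (lt_le_trans alpha_aS_gt1) // ler_pM2l // ler_nat.
Qed.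

(** As 1 / alpha < a + 1 <= 2 * a. *)
Lemma question_bound Q : (#|Q|%:R <= k%:R / alpha)%R -> #|Q| <= 2 * k * a.
Proof.
move=> Qk; rewrite -(ler_nat R) (le_trans Qk) // ler_pdivrMr //.
have : (k%:R * 1 <= k%:R * (alpha * a.+1%:R) :> R)%R.
  by rewrite ler_wpM2l ?ler0n // ltW.
have : (k%:R * (alpha * a.+1%:R) <= k%:R * (alpha * (2 * a)%:R) :> R)%R.
  by rewrite ler_wpM2l ?ler0n // ler_pM2l // ler_nat; lia.
rewrite !natrM; lra.
Qed.

(** The adversary plays q rounds. S collects the elements of the questions of
    size at most a, L the larger questions, and t' is the part of the tree
    reached; a D that avoids S and meets each member of L at most once is
    consistent with all the answers. The empty question is the exception: it is
    answered YES whatever D is. The tree may stop before q rounds; t' is then an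
    [Output] node and the truncated subtraction keeps the last bound true. *)
Lemma stall_strategy q t : small_questions k alpha t ->
  exists (S : {set 'I_n}) (L : seq {set 'I_n}) (t' : strategy n),
  [/\ #|S| + a * size L <= a * q,
      all (fun Q => #|Q| <= 2 * k * a) L &
      forall D, D \subset ~: S -> all (fun Q => #|Q :&: D| <= 1) L ->
        output alpha t D = output alpha t' D /\
        nquestions alpha t' D <= nquestions alpha t D - q].
Proof.
elim: q t => [|q IH] t.
  move=> _; exists finset.set0, [::], t; split=> //= [|D _ _]; last by rewrite subn0.
  by rewrite cards0 !muln0.
case: t => [M|Q ty tn] /=.
  move=> _; exists finset.set0, [::], (Output M); split=> //=.
  by rewrite cards0 !muln0.
case=> Qk Hy Hn; have [->|Q0] := eqVneq Q finset.set0.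
  have [S [L [t' [SL Lb eqt]]]] := IH ty Hy.
  exists S, L, t'; split=> // [|D DS DL].
    by rewrite (leq_trans SL) // leq_mul2l leqnSn orbT.
  by rewrite answer_set0 subSS; exact: eqt.
have [S [L [t' [SL Lb eqt]]]] := IH tn Hn.
have [Qa|aQ] := leqP #|Q| a.
  exists (Q :|: S), L, t'; split=> // [|D].
    rewrite mulnS; apply: leq_trans (leq_add Qa SL).
    by rewrite addnA leq_add2r leq_card_setU.
  rewrite finset.setCU finset.subsetI => /andP[DQ DS] DL; rewrite answer_disjoint // ?subSS.
    exact: eqt.
  apply/eqP; rewrite cards_eq0 setI_eq0 disjoint_sym finset.disjoints_subset.
  exact: DQ.
exists S, (Q :: L), t'; split=> /= [||D DS /andP[DQ DL]].
- by rewrite !mulnS addnCA leq_add2l.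
- by rewrite question_bound.
- by rewrite answer_large // subSS; exact: eqt.
Qed.

(** A tree of depth d has at most 2 ^ d leaves, and a leaf with output M serves
    only sets D that contain M. The factor u clears the denominator of the
    proportion of such D. *)
Lemma card_le_pow_nquestions (m u B d : nat) t (F : {set {set 'I_n}}) :
  (forall M : {set 'I_n}, #|M| = m -> #|[set D in F | M \subset D]| * u <= B) ->
  (forall D, D \in F -> [/\ #|output alpha t D| = m,
      output alpha t D \subset D & nquestions alpha t D <= d]) ->
  #|F| * u <= 2 ^ d * B.
Proof.
elim: t d F => [M|Q ty IHy tn IHn] d F FB Ft.
  have [->|[D0 FD0]] := set_0Vmem F; first by rewrite cards0.
  have [Mm _ _] := Ft _ FD0.
  rewrite (leq_trans _ (leq_pmull _ _)) ?expn_gt0 // (leq_trans _ (FB _ Mm)) //.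
  rewrite leq_mul2r; apply/orP; right; apply/subset_leq_card/fintype.subsetP => D FD.
  by rewrite inE FD; have [] := Ft _ FD.
case: d Ft => [|d] Ft.
  have [->|[D0 FD0]] := set_0Vmem F; first by rewrite cards0.
  by have [_ _] := Ft _ FD0.
pose Fy := [set D in F | answer alpha D Q].
pose Fn := [set D in F | ~~ answer alpha D Q].
have cF : #|F| = #|Fy| + #|Fn|.
  rewrite -(cardsID [set D | answer alpha D Q] F); congr (_ + _);
    by apply: eq_card => D; rewrite !inE // andbC.
have sub (G : {set {set 'I_n}}) : G \subset F -> forall M : {set 'I_n}, #|M| = m ->
    #|[set D in G | M \subset D]| * u <= B.
  move=> /fintype.subsetP GF M Mm; rewrite (leq_trans _ (FB _ Mm)) // leq_mul2r.
  apply/orP; right; apply/subset_leq_card/fintype.subsetP => D; rewrite !inE.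
  by case/andP => /GF -> ->.
rewrite cF mulnDl expnS mul2n -addnn mulnDl; apply: leq_add.
  apply: IHy => [|D]; first by apply: sub; apply/fintype.subsetP => D /[!inE] /andP[].
  by rewrite inE => /andP[/Ft /= FtD DQ]; rewrite DQ ltnS in FtD.
apply: IHn => [|D]; first by apply: sub; apply/fintype.subsetP => D /[!inE] /andP[].
by rewrite inE => /andP[/Ft /= FtD /negbTE DQ]; rewrite DQ ltnS in FtD.
Qed.

(** Information bound for the remaining tree: the factor 2 * k ^ m over the
    ideal 2 ^ d pays for the k-subsets lost to L and for M being any m elements
    out of the k in D. *)
Lemma expn_card_le (m d : nat) W (L : seq {set 'I_n}) t :
  m <= k <= #|W| ->
  'C(#|W|, k) <= 2 * #|sparse_ksubsets W k L| ->
  (forall D, D \in sparse_ksubsets W k L -> [/\ #|output alpha t D| = m,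
      output alpha t D \subset D & nquestions alpha t D <= d]) ->
  #|W| ^ m <= 2 ^ d.+1 * k ^ m.
Proof.
move=> /andP[mk kW] half tF.
have C0 : 0 < 'C(#|W|, k) by rewrite bin_gt0.
have K0 : 0 < k ^_ m by rewrite ffact_gt0.
have : #|sparse_ksubsets W k L| * #|W| ^_ m <= 2 ^ d * ('C(#|W|, k) * k ^_ m).
  apply: card_le_pow_nquestions tF => M <-.
  apply: leq_trans (card_ksubset_supset W M k); rewrite leq_mul2r.
  apply/orP; right; apply/subset_leq_card/fintype.subsetP => D; rewrite !inE.
  by case/andP => /and3P[-> -> _] ->.
move=> H; have {}H : #|W| ^_ m <= 2 ^ d.+1 * k ^_ m.
  rewrite -(leq_pmul2l C0) (leq_trans (leq_mul half (leqnn _))) //.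
  rewrite -mulnA (leq_trans (leq_mul (leqnn 2) H)) //.
  by rewrite expnS; apply/eq_leq; ring.
rewrite -(leq_pmul2r K0) (leq_trans (expn_ffact_le mk kW)) //.
by rewrite (leq_trans (leq_mul H (leqnn _))) //; apply/eq_leq; ring.
Qed.

(** This is n / a + m * log a <= q + 4 * k ^ 4 + 1 + m * log k without
    logarithms. The constant c = 4 * k ^ 4 makes the union bound work: with l
    large questions there are N >= a * (c + l) survivors, so N * (N - 1) is at
    least 2 * c * l * a ^ 2, the double of l * (2 * k * a) ^ 2 * k ^ 2. *)
Lemma suffices_lower (m q : nat) : 1 <= m <= k -> k <= n -> a <= n ->
  suffices n k alpha m q ->
  a ^ m * 2 ^ (n %/ a) <= 2 ^ (q + 4 * k ^ 4 + 1) * k ^ m.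
Proof.
move=> /andP[m1 mk] kn an [t [tsmall tfinds tq]].
have k1 : 0 < k by exact: leq_trans mk.
pose c := 4 * k ^ 4; pose q0 := n %/ a - c.
have kk4 : k <= k ^ 4 by rewrite -[leqLHS]expn1 leq_pexp2l.
have [S [L [t' [SL Lb eqt]]]] := stall_strategy q0 tsmall.
pose W := ~: S.
have cW : #|S| + #|W| = n by rewrite cardsC card_ord.
have W0 : q0 = 0 -> L = [::] /\ #|W| = n.
  move=> q00; move: SL; rewrite q00 muln0 leqn0 addn_eq0 muln_eq0.
  by case/andP => /eqP S0 /orP[/eqP|/nilP ->]; [move: a_gt0; lia|split=> //; lia].
have Wbig : 0 < q0 -> a * (c + size L) <= #|W|.
  move=> q0_gt0; have : n %/ a * a <= n := leq_trunc_div n a.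
  by have : n %/ a = q0 + c; [rewrite subnK //; lia|move=> ->; nia].
have aW : a <= #|W|.
  have [/W0[_ ->] //|/Wbig] := posnP q0; apply: leq_trans.
  by rewrite leq_pmulr //; lia.
have kW : k <= #|W|.
  have [/W0[_ ->] //|/Wbig] := posnP q0; apply: leq_trans.
  by apply: (@leq_trans c); [lia|nia].
have half : 'C(#|W|, k) <= 2 * #|sparse_ksubsets W k L|.
  apply: half_ksubsets_sparse Lb _.
  have [/W0[-> _] //|/Wbig WL] := posnP q0.
  have [->//|L0] := posnP (size L).
  have k2 : k ^_ 2 <= k ^ 2 by rewrite !ffactnS ffactn0 muln1 leq_mul ?leq_pred.
  have cE : (2 * k * a) ^ 2 * k ^ 2 = c * (a * a) by rewrite /c; ring.
  apply: (@leq_trans (2 * (size L * (c * (a * a))))).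
    by rewrite !leq_mul2l -cE leq_mul2l k2 !orbT.
  rewrite !ffactnS ffactn0 muln1.
  apply: (@leq_trans (a * (c + size L) * (a * (c + size L)).-1)); last first.
    by rewrite leq_mul // -!subn1 leq_sub2r.
  have c4 : 4 <= c by rewrite /c; lia.
  move: (size L) L0 => l; clearbody c.
  have : 0 < a * (c + l) by rewrite muln_gt0 a_gt0; lia.
  move: a_gt0 c4; clear; nia.
have H : #|W| ^ m <= 2 ^ (q - q0).+1 * k ^ m.
  apply: (@expn_card_le m (q - q0) W L t') => //; first by rewrite mk.
  move=> D; rewrite inE => /and3P[DW /eqP Dk DL].
  have kD : k <= #|D| by rewrite Dk.
  have [<- tD] := eqt D DW DL.
  have [-> ->] := tfinds D kD; split=> //.
  by rewrite (leq_trans tD) // leq_sub2r // tq.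
(* If t made fewer than q0 questions, t' would be a single leaf, too few for the
   more than 2 * k survivors. *)
have q0q : q0 <= q.
  rewrite leqNgt; apply/negP => qq0; move: H; apply/negP; rewrite -ltnNge.
  rewrite (_ : q - q0 = 0) ?expn1; last lia.
  have kW2 : 2 * k < #|W|.
    have : a * (c + size L) <= #|W| by apply: Wbig; lia.
    have : c <= a * (c + size L) by nia.
    lia.
  apply: (@leq_ltn_trans ((2 * k) ^ m)); last by rewrite ltn_exp2r.
  by rewrite expnMn leq_mul2r -[leqLHS]expn1 leq_pexp2l ?orbT.
apply: (@leq_trans (#|W| ^ m * 2 ^ (q0 + c))).
  by rewrite leq_mul ?leq_exp2r ?leq_exp2l // /q0; lia.
rewrite (leq_trans (leq_mul H (leqnn _))) //.
by rewrite mulnAC -expnD leq_mul2r leq_exp2l // -/c; lia.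
Qed.

End LowerBound.

(** * Upper bound: group testing *)

Section UpperBound.

Variables (R : realType) (alpha : R) (n k a : nat).
Hypothesis alpha_gt0 : (0 < alpha)%R.
Hypothesis alpha_a_le1 : (alpha * a%:R <= 1)%R.
Hypothesis a_gt0 : 0 < a.

Implicit Types (D Q S U Y : {set 'I_n}) (P : {set 'I_n} -> Prop).

Lemma answer_small D Q : Q != finset.set0 -> #|Q| <= a ->
  answer alpha D Q = (Q :&: D != finset.set0).
Proof.
move=> Q0 Qa; have [/eqP QD|QD] := boolP (Q :&: D == finset.set0).
  by rewrite answer_disjoint // QD cards0.
rewrite /answer (le_trans (y := 1%R)) //; last by rewrite ler1n card_gt0.
by rewrite (le_trans _ alpha_a_le1) // ler_pM2l // ler_nat.
Qed.

(** P describes what is known about the defective set; arguing on P instead of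
    on trees lets an algorithm be described by how its knowledge evolves. *)
Definition achieves (m : nat) (P : {set 'I_n} -> Prop) (q : nat) :=
  exists t : strategy n, small_questions k alpha t /\
    forall D, P D -> [/\ #|output alpha t D| = m, output alpha t D \subset D &
                        nquestions alpha t D <= q].

Lemma achieves_void m P q : (forall D, ~ P D) -> achieves m P q.
Proof. by move=> P0; exists (Output finset.set0); split=> // D /P0. Qed.

Lemma achieves_output m P (M : {set 'I_n}) q : #|M| = m ->
  (forall D, P D -> M \subset D) -> achieves m P q.
Proof. by move=> Mm MP; exists (Output M); split=> // D PD; split=> //; exact: MP. Qed.

Lemma achieves_weaken m (P P' : {set 'I_n} -> Prop) q q' :
  (forall D, P' D -> P D) -> q <= q' -> achieves m P q -> achieves m P' q'.
Proof.
move=> PP qq [t [ts tP]]; exists t; split=> // D /PP /tP[? ? tq].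
by split=> //; apply: leq_trans qq.
Qed.

Lemma achieves_ask m P Q q : 0 < k -> Q != finset.set0 -> #|Q| <= a ->
  achieves m (fun D => P D /\ Q :&: D != finset.set0) q ->
  achieves m (fun D => P D /\ Q :&: D = finset.set0) q ->
  achieves m P q.+1.
Proof.
move=> k0 Q0 Qa [ty [tys tyP]] [tn [tns tnP]]; exists (Ask Q ty tn); split.
  split=> //; rewrite ler_pdivlMr // mulrC (le_trans (y := 1%R)) //.
    by rewrite (le_trans _ alpha_a_le1) // ler_pM2l // ler_nat.
  by rewrite ler1n.
move=> D PD /=; rewrite answer_small // ltnS.
by have [/eqP QD|QD] := boolP (Q :&: D == finset.set0); [exact: tnP|exact: tyP].
Qed.

(** Binary search for a defective in a set S known to contain one: after j
    questions some x in S is known to be defective. *)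
Lemma achieves_search m j q P S : 0 < k -> #|S| <= 2 ^ j -> #|S| <= a ->
  (forall D, P D -> S :&: D != finset.set0) ->
  (forall x, x \in S -> achieves m (fun D => P D /\ x \in D) q) ->
  achieves m P (j + q).
Proof.
move=> k0; elim: j P S => [|j IH] P S Sj Sa PS Sq.
  have [S0|[x xS]] := set_0Vmem S.
    by apply: achieves_void => D /PS; rewrite S0 finset.set0I eqxx.
  apply: achieves_weaken (Sq x xS) => // D PD; split=> //.
  have /set0Pn[y /setIP[yS yD]] := PS D PD.
  by rewrite ((card_le1_eqP Sj) y x yS xS).
have [Sj'|/ltnW/exists_subset_card[Q QS cQ]] := leqP #|S| (2 ^ j).
  by apply: achieves_weaken (IH P S Sj' Sa PS Sq) => //; rewrite leq_add2r.
have Qa : #|Q| <= a by rewrite (leq_trans (subset_leq_card QS)).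
rewrite addSn; apply: (@achieves_ask _ _ Q) => //.
- by rewrite -card_gt0 cQ expn_gt0.
- apply: (IH _ Q) => [|//|D []//|x xQ]; first by rewrite cQ.
  apply: achieves_weaken (Sq x _) => [D [[]]//|//|].
  exact: (fintype.subsetP QS).
- apply: (IH _ (S :\: Q)) => [||D [PD QD]|x].
  + by rewrite cardsD (finset.setIidPr QS) cQ leq_subLR addnn -mul2n -expnS.
  + by rewrite (leq_trans _ Sa) // subset_leq_card // finset.subsetDl.
  + have /set0Pn[y /setIP[yS yD]] := PS D PD.
    apply/set0Pn; exists y; rewrite !inE yS yD !andbT.
    by apply/negP => yQ; move/finset.setP/(_ y): QD; rewrite !inE yQ yD.
  + rewrite inE => /andP[_ xS].
    by apply: achieves_weaken (Sq x xS) => // D [[]].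
Qed.

(** Y holds the defectives found, r is the number still to be found, and p bounds
    the number of groups that U can still fill. A NO decreases p. A YES costs
    1 + j questions and decreases r; the element found leaves U, which does not
    increase p. *)
Lemma achieves_groups m j r p Y U : 0 < k -> m <= k -> a <= 2 ^ j ->
  #|Y| + r = m -> Y :&: U = finset.set0 -> #|U| <= a * p ->
  achieves m (fun D => [/\ k <= #|D|, Y \subset D & D \subset Y :|: U])
    (p + r * j.+1).
Proof.
move=> k0 mk aj; elim: r p Y U => [|r IHr] p Y U Yr YU Up.
  by apply: (achieves_output (M := Y)) => [|D []//]; rewrite -Yr addn0.
(* With U exhausted, D = Y would have fewer than m <= k elements. *)
have noU U' : U' = finset.set0 -> forall D,
    ~ [/\ k <= #|D|, Y \subset D & D \subset Y :|: U'].
  by move=> -> D [kD _]; rewrite finset.setU0 => /subset_leq_card; lia.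
elim: p U YU Up => [|p IHp] U YU Up.
  apply: achieves_void; apply: noU; apply/eqP.
  by rewrite -cards_eq0 -leqn0 -(muln0 a).
have [U0|Un0] := eqVneq U finset.set0; first by apply: achieves_void; exact: noU.
have [Q QU cQ] := exists_subset_card (geq_minr a #|U|).
have Qa : #|Q| <= a by rewrite cQ geq_minl.
rewrite addSn; apply: (@achieves_ask _ _ Q) => //.
- by rewrite -card_gt0 cQ leq_min a_gt0 card_gt0.
- rewrite (_ : p + r.+1 * j.+1 = j + (p.+1 + r * j.+1)); last by ring.
  apply: (@achieves_search _ _ _ _ Q) => // [|D []//|x xQ].
    exact: leq_trans aj.
  have xU : x \in U := fintype.subsetP QU x xQ.
  have xY : x \notin Y.
    by apply/negP => xY; move/finset.setP/(_ x): YU; rewrite !inE xY xU.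
  apply: achieves_weaken (leqnn _) (IHr p.+1 (x |: Y) (U :\ x) _ _ _).
  + move=> D [[[kD YD DYU] _] xD]; split=> //.
      by rewrite finset.subUset finset.sub1set xD.
    apply/fintype.subsetP => z /(fintype.subsetP DYU); rewrite !inE.
    by case: eqP.
  + by rewrite cardsU1 xY; lia.
  + apply/finset.setP => z; move/finset.setP/(_ z): YU; rewrite !inE.
    by case: eqVneq => [->|_] //=; rewrite andbF.
  + by rewrite (leq_trans _ Up) // subset_leq_card // finset.subsetDl.
- apply: achieves_weaken (leqnn _) (IHp (U :\: Q) _ _).
  + move=> D [[kD YD DYU] QD]; split=> //.
    apply/fintype.subsetP => z zD; have := fintype.subsetP DYU z zD.
    by move/finset.setP/(_ z): QD; rewrite !inE zD andbT => ->.
  + by apply/eqP; rewrite -finset.subset0 -YU finset.setIS // finset.subsetDl.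
  + rewrite cardsD (finset.setIidPr QU) cQ; move: Up; rewrite mulnS; lia.
Qed.

Lemma suffices_upper (m : nat) : 1 <= m <= k ->
  suffices n k alpha m ((n %/ a).+1 + m * (trunc_log 2 a).+2).
Proof.
move=> /andP[m1 mk]; have k0 : 0 < k by exact: leq_trans mk.
have [||||t [ts tP]] := @achieves_groups m (trunc_log 2 a).+1 m (n %/ a).+1
    finset.set0 finset.setT k0 mk.
- by rewrite ltnW // trunc_log_ltn.
- by rewrite cards0.
- by rewrite finset.set0I.
- by rewrite cardsT card_ord mulnC ltnW // ltn_ceil.
have tD D : k <= #|D| -> [/\ k <= #|D|, finset.set0 \subset D
                           & D \subset finset.set0 :|: finset.setT].
  by move=> kD; rewrite finset.sub0set finset.set0U finset.subsetT.
by exists t; split=> // D /tD/tP[].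
Qed.

End UpperBound.

Local Close Scope nat_scope.

(** * Logarithmic form of the bounds *)

Lemma log2_le (R : realType) (x y : R) : 0 < x -> x <= y -> log2 x <= log2 y.
Proof.
move=> x0 xy; rewrite /log2 ler_pM2r ?invr_gt0 ?ln_gt0 ?ltr1n //.
by rewrite ler_ln ?posrE ?(lt_le_trans x0).
Qed.

Lemma log2M (R : realType) (x y : R) : 0 < x -> 0 < y ->
  log2 (x * y) = log2 x + log2 y.
Proof. by move=> x0 y0; rewrite /log2 lnM ?posrE // mulrDl. Qed.

Lemma log2X (R : realType) (x : R) (i : nat) : 0 < x ->
  log2 (x ^+ i) = i%:R * log2 x.
Proof. by move=> x0; rewrite /log2 lnXn // -[ln x *+ i]mulr_natl mulrA. Qed.

Lemma log2_2X (R : realType) (i : nat) : log2 (2 ^+ i) = i%:R :> R.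
Proof. by rewrite log2X // /log2 divff ?mulr1 // gt_eqF // ln_gt0 // ltr1n. Qed.

Theorem theorem7 (R : realType) :
  exists c1 c2 : nat -> R,
    forall (n k m : nat) (alpha : R),
      (k <= n)%N -> (1 <= m <= k)%N -> 0 < alpha < 1 ->
      let a : R := (Num.floor (1 / alpha))%:~R in
      (a <= n%:R ->
         n%:R / a + m%:R * log2 a - c1 k <= (g n k alpha m)%:R) /\
      (g n k alpha m)%:R <= n%:R / a + m%:R * log2 a + c2 k.
Proof.
exists (fun k => (4 * k ^ 4 + 2)%:R + k%:R * log2 k%:R),
  (fun k => (2 * k + 1)%:R).
move=> n k m alpha kn mk alpha01 a'.
have [gs gmin] := g_least n mk alpha01.
have [alpha0 alpha1] := andP alpha01; have [m1 mlek] := andP mk.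
have inv0 : 0 <= 1 / alpha by rewrite divr_ge0 // ltW.
pose a := Num.trunc (1 / alpha).
have a'E : a' = a%:R.
  by rewrite /a' /a [in RHS]truncn_floor inv0 natr_absz ger0_norm // floor_ge0.
have a_gt0 : (0 < a)%N by rewrite truncn_gt0 ler_pdivlMr // mul1r ltW.
have aR0 : 0 < a%:R :> R by rewrite ltr0n.
have [aE aE'] := andP (truncn_itv inv0); rewrite -/a in aE aE'.
have alpha_a : alpha * a%:R <= 1 by rewrite mulrC -ler_pdivlMr.
have alpha_aS : 1 < alpha * a.+1%:R by rewrite mulrC -ltr_pdivrMr.
have k0 : 0 < k%:R :> R by rewrite ltr0n (leq_trans m1).
have div_le : (n %/ a)%:R <= n%:R / a%:R :> R.
  by rewrite ler_pdivlMr // -natrM ler_nat leq_trunc_div.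
have div_gt : n%:R / a%:R <= (n %/ a)%:R + 1 :> R.
  by rewrite ler_pdivrMr // natr1 -natrM ler_nat ltnW // ltn_ceil.
rewrite a'E; split => [|].
  rewrite ler_nat => an.
  have := suffices_lower alpha0 alpha_aS a_gt0 mk kn an gs.
  rewrite -(ler_nat R) !natrM !natrX => /log2_le.
  rewrite !log2M ?exprn_gt0 ?log2_2X ?log2X // => /(_ (mulr_gt0 _ _)).
  rewrite !exprn_gt0 // => /(_ isT isT).
  have : m%:R * log2 k%:R <= k%:R * log2 k%:R :> R.
    rewrite ler_wpM2r ?ler_nat // /log2 divr_ge0 ?ln_ge0 ?ler1n //.
    exact: leq_trans mlek.
  rewrite !natrD; lra.
have := gmin _ (suffices_upper n alpha0 alpha_a a_gt0 mk).
rewrite -(ler_nat R).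
have -> : ((n %/ a).+1 + m * (trunc_log 2 a).+2)%:R =
    (n %/ a)%:R + 1 + m%:R * (trunc_log 2 a)%:R + 2 * m%:R :> R.
  by rewrite natrD natrM -!natr1; ring.
move=> gle.
have : (trunc_log 2 a)%:R <= log2 a%:R :> R.
  rewrite -log2_2X log2_le // ?exprn_gt0 // -natrX ler_nat.
  exact: trunc_logP.
move/(ler_wpM2l (ler0n _ m)).
have : m%:R <= k%:R :> R by rewrite ler_nat.
move: gle; rewrite natrD natrM.
lra.
Qed.
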